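(* Let $P$, $Q$ be CP terms. If $P\Longrightarrow Q$ in CP, then $[\![P]\!]\Longrightarrow[\![Q]\!]$ in HCP.
   Context: CP terms: $P,Q,R ::= x\leftrightarrow y \mid \nu x(P\parallel Q)$ (cut; $x$ bound in $P$ and $Q$) $\mid x[y](P\parallel Q)$ (output; $y$ bound in $P$, $x$ continues in $Q$) $\mid x(y).P$ ($y$ bound in $P$) $\mid x[].0 \mid x().P \mid x\triangleleft\mathrm{inl}.P\mid x\triangleleft\mathrm{inr}.P\mid x\triangleright\{\mathrm{inl}:P;\mathrm{inr}:Q\}\mid x\triangleright\{\}$. CP structural congruence $\equiv$: smallest congruence containing $x\leftrightarrow y\equiv y\leftrightarrow x$; $\nu x(P\parallel Q)\equiv \nu x(Q\parallel P)$; $\nu x(P\parallel \nu y(Q\parallel R))\equiv \nu y(\nu x(P\parallel Q)\parallel R)$ if $x$ not free in $R$ and $y$ not free in $P$. CP reduction $\Longrightarrow$: smallest relation closed under $\nu x(w\leftrightarrow x\parallel P)\Longrightarrow P\{w/x\}$; $\nu x(x[y](P\parallel Q)\parallel x(y).R)\Longrightarrow \nu y(P\parallel \nu x(Q\parallel R))$; $\nu x(x[].0\parallel x().P)\Longrightarrow P$; $\nu x(x\triangleleft\mathrm{inl}.P\parallel x\triangleright\{\mathrm{inl}:Q;\mathrm{inr}:R\})\Longrightarrow \nu x(P\parallel Q)$; $\nu x(x\triangleleft\mathrm{inr}.P\parallel x\triangleright\{\mathrm{inl}:Q;\mathrm{inr}:R\})\Longrightarrow \nu x(P\parallel R)$;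 if $P\Longrightarrow P'$ then $\nu x(P\parallel Q)\Longrightarrow \nu x(P'\parallel Q)$; if $P\equiv Q\Longrightarrow Q'\equiv P'$ then $P\Longrightarrow P'$. HCP terms: $P,Q,R ::= x\leftrightarrow y \mid 0 \mid (\nu x)P$ (binds $x$) $\mid (P \mid Q) \mid x[y].P$ ($y$ bound in $P$) $\mid x(y).P$ ($y$ bound in $P$) $\mid x[].P \mid x().P \mid x\triangleleft \mathrm{inl}.P \mid x\triangleleft\mathrm{inr}.P \mid x\triangleright\{\mathrm{inl}:P;\mathrm{inr}:Q\} \mid x\triangleright\{\}$. HCP structural congruence $\equiv$: smallest congruence containing $x\leftrightarrow y\equiv y\leftrightarrow x$; $(P\mid 0)\equiv P$; $(P\mid Q)\equiv(Q\mid P)$; $(P\mid(Q\mid R))\equiv((P\mid Q)\mid R)$; $(\nu x)(\nu y)P\equiv(\nu y)(\nu x)P$; $(\nu x)(P\mid Q)\equiv (P\mid(\nu x)Q)$ if $x$ not free in $P$. HCP reduction $\Longrightarrow$: smallest relation closed under $(\nu x)(w\leftrightarrow x \mid P)\Longrightarrow P\{w/x\}$; $(\nu x)(x[y].P \mid x(y).R) \Longrightarrow (\nu x)(\nu y)(P\mid R)$; $(\nu x)(x[].P\mid x().Q)\Longrightarrow (P\mid Q)$; $(\nu x)(x\triangleleft\mathrm{inl}.P\mid x\triangleright\{\mathrm{inl}:Q;\mathrm{inr}:R\})\Longrightarrow(\nu x)(P\mid Q)$; $(\nu x)(x\triangleleft\mathrm{inr}.P\mid x\triangleright\{\mathrm{inl}:Q;\mathrm{inr}:R\})\Longrightarrow(\nu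 x)(P\mid R)$; if $P\Longrightarrow P'$ then $(\nu x)P\Longrightarrow(\nu x)P'$ and $(P\mid Q)\Longrightarrow(P'\mid Q)$; if $P\equiv Q\Longrightarrow Q'\equiv P'$ then $P\Longrightarrow P'$. The translation $[\![\cdot]\!]$ from CP to HCP terms: $[\![x\leftrightarrow y]\!]=x\leftrightarrow y$; $[\![\nu x(P\parallel Q)]\!]=(\nu x)([\![P]\!]\mid[\![Q]\!])$; $[\![x[y](P\parallel Q)]\!]=x[y].([\![P]\!]\mid[\![Q]\!])$; $[\![x(y).P]\!]=x(y).[\![P]\!]$; $[\![x[].0]\!]=x[].0$; $[\![x().P]\!]=x().[\![P]\!]$; $[\![x\triangleleft\mathrm{inl}.P]\!]=x\triangleleft\mathrm{inl}.[\![P]\!]$; $[\![x\triangleleft\mathrm{inr}.P]\!]=x\triangleleft\mathrm{inr}.[\![P]\!]$; $[\![x\triangleright\{\mathrm{inl}:P;\mathrm{inr}:Q\}]\!]=x\triangleright\{\mathrm{inl}:[\![P]\!];\mathrm{inr}:[\![Q]\!]\}$; $[\![x\triangleright\{\}]\!]=x\triangleright\{\}$.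
   Formalization: In the CP rule for output against input, x is required not to be free in P (else the reduct releases the bound x and the claim fails, e.g. P = x↔y, Q = x[].0), and the bound y is chosen not free in Q, which is only alpha-renaming. *)

(* Defs.v *)
From mathcomp Require Import all_boot.

Set Implicit Arguments.
Unset Strict Implicit.
Unset Printing Implicit Defensive.

(** Terms are taken up to alpha-equivalence, as nested datatypes: [cp V] is the
    type of terms whose free names lie in [V], and a binder is an argument of
    type [cp (option V)] in which [None] is the bound name.  The congruences
    and reductions live on [cp name] and [hcp name], and are written with the
    named binders [Cnu x P Q], [Hout x y P], etc., each of which abstracts a
    concrete name, so that alpha-equivalent named terms are equal. *)

Definition name := nat.

Definition abs_name (x y : name) : option name :=
  if y == x then None else Some y.

Definition subst_name (w x y : name) : name := if y == x then w else y.

Inductive cp (V : Type) : Type :=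
| CLink (x y : V)
| CCut (P Q : cp (option V))
| COut (x : V) (P : cp (option V)) (Q : cp V)
| CIn (x : V) (P : cp (option V))
| CClose (x : V)
| CWait (x : V) (P : cp V)
| CInl (x : V) (P : cp V)
| CInr (x : V) (P : cp V)
| CCase (x : V) (P Q : cp V)
| CAbsurd (x : V).

Fixpoint cmap (V W : Type) (f : V -> W) (T : cp V) : cp W :=
  match T with
  | CLink x y => CLink (f x) (f y)
  | CCut P Q => CCut (cmap (omap f) P) (cmap (omap f) Q)
  | COut x P Q => COut (f x) (cmap (omap f) P) (cmap f Q)
  | CIn x P => CIn (f x) (cmap (omap f) P)
  | CClose x => CClose (f x)
  | CWait x P => CWait (f x) (cmap f P)
  | CInl x P => CInl (f x) (cmap f P)
  | CInr x P => CInr (f x) (cmap f P)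
  | CCase x P Q => CCase (f x) (cmap f P) (cmap f Q)
  | CAbsurd x => CAbsurd (f x)
  end.

Fixpoint cfree (V : Type) (z : V) (T : cp V) : Prop :=
  match T with
  | CLink x y => z = x \/ z = y
  | CCut P Q => cfree (Some z) P \/ cfree (Some z) Q
  | COut x P Q => z = x \/ cfree (Some z) P \/ cfree z Q
  | CIn x P => z = x \/ cfree (Some z) P
  | CClose x => z = x
  | CWait x P => z = x \/ cfree z P
  | CInl x P => z = x \/ cfree z P
  | CInr x P => z = x \/ cfree z P
  | CCase x P Q => z = x \/ cfree z P \/ cfree z Q
  | CAbsurd x => z = x
  end.

Definition cabs (x : name) (P : cp name) : cp (option name) :=
  cmap (abs_name x) P.

(** [P{w/x}]; capture is impossible since bound names are not elements of
    [name]. *)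
Definition csubst (w x : name) (P : cp name) : cp name :=
  cmap (subst_name w x) P.

Definition Cnu (x : name) (P Q : cp name) : cp name :=
  CCut (cabs x P) (cabs x Q).

Definition Cout (x y : name) (P Q : cp name) : cp name := COut x (cabs y P) Q.

Definition Cin (x y : name) (P : cp name) : cp name := CIn x (cabs y P).

Inductive cp_cong : cp name -> cp name -> Prop :=
| cc_link x y : cp_cong (CLink x y) (CLink y x)
| cc_comm x P Q : cp_cong (Cnu x P Q) (Cnu x Q P)
| cc_assoc x y P Q R : ~ cfree x R -> ~ cfree y P ->
    cp_cong (Cnu x P (Cnu y Q R)) (Cnu y (Cnu x P Q) R)
| cc_refl P : cp_cong P P
| cc_sym P Q : cp_cong P Q -> cp_cong Q P
| cc_trans P Q R : cp_cong P Q -> cp_cong Q R -> cp_cong P R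
| cc_nu x P P' Q Q' : cp_cong P P' -> cp_cong Q Q' ->
    cp_cong (Cnu x P Q) (Cnu x P' Q')
| cc_out x y P P' Q Q' : cp_cong P P' -> cp_cong Q Q' ->
    cp_cong (Cout x y P Q) (Cout x y P' Q')
| cc_in x y P P' : cp_cong P P' -> cp_cong (Cin x y P) (Cin x y P')
| cc_wait x P P' : cp_cong P P' -> cp_cong (CWait x P) (CWait x P')
| cc_inl x P P' : cp_cong P P' -> cp_cong (CInl x P) (CInl x P')
| cc_inr x P P' : cp_cong P P' -> cp_cong (CInr x P) (CInr x P')
| cc_case x P P' Q Q' : cp_cong P P' -> cp_cong Q Q' ->
    cp_cong (CCase x P Q) (CCase x P' Q').

(** The side conditions of [cr_out] are the scoping conventions of output: in
    [x[y](P || Q)] the channel [x] continues in [Q] only, and the name [y],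
    bound in [P], is chosen fresh for [Q].  Otherwise the reduct would release
    the bound name [x] of [P] or capture the free name [y] of [Q].  The second
    condition excludes no redex, since [y] can be renamed. *)
Inductive cp_red : cp name -> cp name -> Prop :=
| cr_link w x P : cp_red (Cnu x (CLink w x) P) (csubst w x P)
| cr_out x y P Q R : ~ cfree x P -> ~ cfree y Q ->
    cp_red (Cnu x (Cout x y P Q) (Cin x y R)) (Cnu y P (Cnu x Q R))
| cr_close x P : cp_red (Cnu x (CClose x) (CWait x P)) P
| cr_inl x P Q R : cp_red (Cnu x (CInl x P) (CCase x Q R)) (Cnu x P Q)
| cr_inr x P Q R : cp_red (Cnu x (CInr x P) (CCase x Q R)) (Cnu x P R)
| cr_nu x P P' Q : cp_red P P' -> cp_red (Cnu x P Q) (Cnu x P' Q)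
| cr_cong P Q Q' P' : cp_cong P Q -> cp_red Q Q' -> cp_cong Q' P' ->
    cp_red P P'.

Inductive hcp (V : Type) : Type :=
| HLink (x y : V)
| HNil
| HNu (P : hcp (option V))
| HPar (P Q : hcp V)
| HOut (x : V) (P : hcp (option V))
| HIn (x : V) (P : hcp (option V))
| HClose (x : V) (P : hcp V)
| HWait (x : V) (P : hcp V)
| HInl (x : V) (P : hcp V)
| HInr (x : V) (P : hcp V)
| HCase (x : V) (P Q : hcp V)
| HAbsurd (x : V).

Arguments HNil {V}.

Fixpoint hmap (V W : Type) (f : V -> W) (T : hcp V) : hcp W :=
  match T with
  | HLink x y => HLink (f x) (f y)
  | HNil => HNil
  | HNu P => HNu (hmap (omap f) P)
  | HPar P Q => HPar (hmap f P) (hmap f Q)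
  | HOut x P => HOut (f x) (hmap (omap f) P)
  | HIn x P => HIn (f x) (hmap (omap f) P)
  | HClose x P => HClose (f x) (hmap f P)
  | HWait x P => HWait (f x) (hmap f P)
  | HInl x P => HInl (f x) (hmap f P)
  | HInr x P => HInr (f x) (hmap f P)
  | HCase x P Q => HCase (f x) (hmap f P) (hmap f Q)
  | HAbsurd x => HAbsurd (f x)
  end.

Fixpoint hfree (V : Type) (z : V) (T : hcp V) : Prop :=
  match T with
  | HLink x y => z = x \/ z = y
  | HNil => False
  | HNu P => hfree (Some z) P
  | HPar P Q => hfree z P \/ hfree z Q
  | HOut x P => z = x \/ hfree (Some z) P
  | HIn x P => z = x \/ hfree (Some z) P
  | HClose x P => z = x \/ hfree z P
  | HWait x P => z = x \/ hfree z P
  | HInl x P => z = x \/ hfree z P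
  | HInr x P => z = x \/ hfree z P
  | HCase x P Q => z = x \/ hfree z P \/ hfree z Q
  | HAbsurd x => z = x
  end.

Definition habs (x : name) (P : hcp name) : hcp (option name) :=
  hmap (abs_name x) P.

Definition hsubst (w x : name) (P : hcp name) : hcp name :=
  hmap (subst_name w x) P.

Definition Hnu (x : name) (P : hcp name) : hcp name := HNu (habs x P).

Definition Hout (x y : name) (P : hcp name) : hcp name := HOut x (habs y P).

Definition Hin (x y : name) (P : hcp name) : hcp name := HIn x (habs y P).

Inductive hcp_cong : hcp name -> hcp name -> Prop :=
| hc_link x y : hcp_cong (HLink x y) (HLink y x)
| hc_nil P : hcp_cong (HPar P HNil) P
| hc_comm P Q : hcp_cong (HPar P Q) (HPar Q P)
| hc_assoc P Q R : hcp_cong (HPar P (HPar Q R)) (HPar (HPar P Q) R)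
| hc_swap x y P : hcp_cong (Hnu x (Hnu y P)) (Hnu y (Hnu x P))
| hc_extrude x P Q : ~ hfree x P ->
    hcp_cong (Hnu x (HPar P Q)) (HPar P (Hnu x Q))
| hc_refl P : hcp_cong P P
| hc_sym P Q : hcp_cong P Q -> hcp_cong Q P
| hc_trans P Q R : hcp_cong P Q -> hcp_cong Q R -> hcp_cong P R
| hc_nu x P P' : hcp_cong P P' -> hcp_cong (Hnu x P) (Hnu x P')
| hc_par P P' Q Q' : hcp_cong P P' -> hcp_cong Q Q' ->
    hcp_cong (HPar P Q) (HPar P' Q')
| hc_out x y P P' : hcp_cong P P' -> hcp_cong (Hout x y P) (Hout x y P')
| hc_in x y P P' : hcp_cong P P' -> hcp_cong (Hin x y P) (Hin x y P')
| hc_close x P P' : hcp_cong P P' -> hcp_cong (HClose x P) (HClose x P')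
| hc_wait x P P' : hcp_cong P P' -> hcp_cong (HWait x P) (HWait x P')
| hc_inl x P P' : hcp_cong P P' -> hcp_cong (HInl x P) (HInl x P')
| hc_inr x P P' : hcp_cong P P' -> hcp_cong (HInr x P) (HInr x P')
| hc_case x P P' Q Q' : hcp_cong P P' -> hcp_cong Q Q' ->
    hcp_cong (HCase x P Q) (HCase x P' Q').

Inductive hcp_red : hcp name -> hcp name -> Prop :=
| hr_link w x P : hcp_red (Hnu x (HPar (HLink w x) P)) (hsubst w x P)
| hr_out x y P R :
    hcp_red (Hnu x (HPar (Hout x y P) (Hin x y R))) (Hnu x (Hnu y (HPar P R)))
| hr_close x P Q :
    hcp_red (Hnu x (HPar (HClose x P) (HWait x Q))) (HPar P Q)
| hr_inl x P Q R :
    hcp_red (Hnu x (HPar (HInl x P) (HCase x Q R))) (Hnu x (HPar P Q))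
| hr_inr x P Q R :
    hcp_red (Hnu x (HPar (HInr x P) (HCase x Q R))) (Hnu x (HPar P R))
| hr_nu x P P' : hcp_red P P' -> hcp_red (Hnu x P) (Hnu x P')
| hr_par P P' Q : hcp_red P P' -> hcp_red (HPar P Q) (HPar P' Q)
| hr_cong P Q Q' P' : hcp_cong P Q -> hcp_red Q Q' -> hcp_cong Q' P' ->
    hcp_red P P'.

(** In the output case [hmap Some] moves the translation of [Q] under the
    binder of [y], which is therefore not free in it. *)
Fixpoint tr (V : Type) (T : cp V) : hcp V :=
  match T with
  | CLink x y => HLink x y
  | CCut P Q => HNu (HPar (tr P) (tr Q))
  | COut x P Q => HOut x (HPar (tr P) (hmap Some (tr Q)))
  | CIn x P => HIn x (tr P)
  | CClose x => HClose x HNil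
  | CWait x P => HWait x (tr P)
  | CInl x P => HInl x (tr P)
  | CInr x P => HInr x (tr P)
  | CCase x P Q => HCase x (tr P) (tr Q)
  | CAbsurd x => HAbsurd x
  end.

(* Main.v *)
Require Import Defs.
From mathcomp Require Import all_boot.

(** Every CP rule is matched by one HCP rule up to structural congruence.  The
    delicate case is congruence under an output: the continuation [Q] of
    [x[y](P || Q)] may contain the name that was chosen for the bound [y], so
    [y] is first swapped with a globally fresh name, which is sound because
    HCP congruence is stable under injective renaming. *)

Set Implicit Arguments.
Unset Strict Implicit.
Unset Printing Implicit Defensive.

Lemma eq_hmap_free (V W : Type) (T : hcp V) (f g : V -> W) :
  (forall z, hfree z T -> f z = g z) -> hmap f T = hmap g T.
Proof.
have opt U U' (P : hcp (option U)) (h k : U -> U') :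
    (forall z, hfree (Some z) P -> h z = k z) ->
    forall z, hfree z P -> omap h z = omap k z.
  by move=> E [z|] //= /E->.
elim: T W f g => {V} /=.
- by move=> V x y W f g E; rewrite !E; auto.
- by [].
- by move=> V P IH W f g /opt/IH->.
- by move=> V P IHP Q IHQ W f g E; rewrite (IHP _ f g) ?(IHQ _ f g); auto.
1-2: by move=> V x P IH W f g E;
  rewrite (IH _ (omap f) (omap g)) ?E; auto; apply: opt; auto.
1-4: by move=> V x P IH W f g E; rewrite (IH _ f g) ?E; auto.
- move=> V x P IHP Q IHQ W f g E.
  by rewrite (IHP _ f g) ?(IHQ _ f g) ?E; auto.
- by move=> V x W f g E; rewrite E.
Qed.

Lemma eq_hmap (V W : Type) (f g : V -> W) : f =1 g -> hmap f =1 hmap g.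
Proof. by move=> E T; apply: eq_hmap_free => z _; apply: E. Qed.

Lemma hmap_comp (V W X : Type) (g : W -> X) (f : V -> W) (T : hcp V) :
  hmap g (hmap f T) = hmap (g \o f) T.
Proof.
have opt U U' U'' (k : U' -> U'') (h : U -> U') :
    omap k \o omap h =1 omap (k \o h) by case.
elim: T W X g f => {V} //= V.
- by move=> P IH W X g f; rewrite IH (eq_hmap (opt _ _ _ _ _)).
- by move=> P IHP Q IHQ W X g f; rewrite IHP IHQ.
- by move=> x P IH W X g f; rewrite IH (eq_hmap (opt _ _ _ _ _)).
- by move=> x P IH W X g f; rewrite IH (eq_hmap (opt _ _ _ _ _)).
- by move=> x P IH W X g f; rewrite IH.
- by move=> x P IH W X g f; rewrite IH.
- by move=> x P IH W X g f; rewrite IH.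
- by move=> x P IH W X g f; rewrite IH.
- by move=> x P IHP Q IHQ W X g f; rewrite IHP IHQ.
Qed.

Lemma hfree_hmap (V W : Type) (f : V -> W) (T : hcp V) (w : W) :
  hfree w (hmap f T) -> exists2 z, w = f z & hfree z T.
Proof.
have opt U U' (h : U -> U') P u :
    (exists2 z, Some u = omap h z & hfree z P) ->
    exists2 z, u = h z & hfree (Some z) P.
  by case=> -[z|] //= [->]; exists z.
elim: T W f w => {V} /= V.
- by move=> x y W f w [] ->; [exists x | exists y]; auto.
- by [].
- by move=> P IH W f w wP; apply/opt/IH.
- by move=> P IHP Q IHQ W f w [/(IHP _ f)|/(IHQ _ f)] [z -> ?]; exists z; auto.
1-2: by move=> x P IH W f w [->|wP];
  [exists x | have [z -> zP] := opt _ _ _ _ _ (IH _ _ _ wP); exists z]; auto.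
1-4: by move=> x P IH W f w [->|/(IH _ f)[z ->]]; [exists x | exists z]; auto.
- by move=> x P IHP Q IHQ W f w [->|[/(IHP _ f)[z ->]|/(IHQ _ f)[z ->]]];
    [exists x | exists z | exists z]; auto.
- by move=> x W f w ->; exists x.
Qed.

Lemma hfree_hmap_inj (V W : Type) (f : V -> W) (T : hcp V) (z : V) :
  injective f -> hfree (f z) (hmap f T) -> hfree z T.
Proof. by move=> f_inj zT; have [y /f_inj->] := hfree_hmap zT. Qed.

(** Abstraction and substitution of CP names are both instances of [cmap], so this naturality makes
    [tr] commute with both. *)
Lemma tr_cmap (V W : Type) (f : V -> W) (T : cp V) :
  tr (cmap f T) = hmap f (tr T).
Proof.
elim: T W f => {V} //= V.
- by move=> P IHP Q IHQ W f; rewrite IHP IHQ.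
(* The weakened continuation is renamed by [Some \o f] on one side and by [omap f \o Some] on the
   other, and these agree pointwise. *)
- move=> x P IHP Q IHQ W f; rewrite IHP IHQ !hmap_comp.
  by congr (HOut _ (HPar _ _)); apply: eq_hmap.
- by move=> x P IH W f; rewrite IH.
- by move=> x P IH W f; rewrite IH.
- by move=> x P IH W f; rewrite IH.
- by move=> x P IH W f; rewrite IH.
- by move=> x P IHP Q IHQ W f; rewrite IHP IHQ.
Qed.

Lemma hfree_tr (V : Type) (T : cp V) (z : V) : hfree z (tr T) -> cfree z T.
Proof.
elim: T z => {V} /= V; try by firstorder.
move=> x P IHP Q IHQ z [->|[/IHP|/(hfree_hmap_inj Some_inj)/IHQ]]; auto.
Qed.

Lemma notfree_tr (V : Type) (T : cp V) (z : V) :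
  ~ cfree z T -> ~ hfree z (tr T).
Proof. exact/contra_not/hfree_tr. Qed.

(** The generality in [V] and [f] is what lets the induction pass binders. *)
Lemma hfree_bounded (V : Type) (T : hcp V) (f : V -> nat) :
  exists n, forall z, hfree z T -> f z < n.
Proof.
(* The bound name gets the dummy value 0 from [oapp h 0]; a bound on the body then restricts to the
   names of the form [Some z]. *)
have opt U (P : hcp (option U)) (h : U -> nat) n :
    (forall z, hfree z P -> oapp h 0 z < n) ->
    forall z, hfree (Some z) P -> h z < n.
  by move=> H z /H.
elim: T f => {V} /= V.
- move=> x y f; exists (maxn (f x) (f y)).+1 => z.
  by case=> ->; rewrite ltnS leq_max leqnn ?orbT.
- by move=> f; exists 0.
- by move=> P IH f; have [n /opt Hn] := IH (oapp f 0); exists n.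
- move=> P IHP Q IHQ f; have [[m Hm] [n Hn]] := (IHP f, IHQ f).
  by exists (maxn m n) => z [/Hm|/Hn]; rewrite leq_max => ->; rewrite ?orbT.
- move=> x P IH f; have [n /opt Hn] := IH (oapp f 0).
  exists (maxn (f x).+1 n) => z.
  by case=> [->|/Hn]; rewrite leq_max ?leqnn // => ->; rewrite orbT.
- move=> x P IH f; have [n /opt Hn] := IH (oapp f 0).
  exists (maxn (f x).+1 n) => z.
  by case=> [->|/Hn]; rewrite leq_max ?leqnn // => ->; rewrite orbT.
1-4: move=> x P IH f; have [n Hn] := IH f;
  exists (maxn (f x).+1 n) => z;
  by case=> [->|/Hn]; rewrite leq_max ?leqnn // => ->; rewrite orbT.
- move=> x P IHP Q IHQ f; have [[m Hm] [n Hn]] := (IHP f, IHQ f).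
  exists (maxn (f x).+1 (maxn m n)) => z.
  by case=> [->|[/Hm|/Hn]]; rewrite !leq_max ?leqnn // => ->; rewrite ?orbT.
- by move=> x f; exists (f x).+1 => z ->.
Qed.

Lemma exists_fresh (T : hcp name) : exists z, ~ hfree z T.
Proof.
have [n Hn] := hfree_bounded T id.
by exists n => /Hn; rewrite ltnn.
Qed.

(** A vacuous abstraction is a weakening, so the [hmap Some] in the output clause of [tr] can be
    read as abstraction of any fresh name. *)
Lemma habs_fresh (x : name) (P : hcp name) :
  ~ hfree x P -> habs x P = hmap Some P.
Proof.
move=> xP; apply: eq_hmap_free => z zP; rewrite /abs_name.
by case: eqP => // zx; case: xP; rewrite -zx.
Qed.

(** Injectivity prevents a name other than [x] from being sent to [f x] and captured. *)
Lemma hmap_habs (f : name -> name) (x : name) (P : hcp name) :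
  injective f -> hmap (omap f) (habs x P) = habs (f x) (hmap f P).
Proof.
move=> f_inj; rewrite /habs !hmap_comp; apply: eq_hmap => z /=.
by rewrite /abs_name (inj_eq f_inj); case: eqP.
Qed.

Lemma hmap_Hnu (f : name -> name) (x : name) (P : hcp name) :
  injective f -> hmap f (Hnu x P) = Hnu (f x) (hmap f P).
Proof. by move=> f_inj; rewrite /Hnu -hmap_habs. Qed.

(** Each rule instance is sent to an instance of the same rule, with the named binders renamed by
    [f]; injectivity also preserves the side condition of [hc_extrude]. *)
Lemma hcp_cong_hmap (f : name -> name) (P Q : hcp name) :
  injective f -> hcp_cong P Q -> hcp_cong (hmap f P) (hmap f Q).
Proof.
move=> f_inj; elim=> {P Q};
  try by (move=> * /=; econstructor; eauto).
- by move=> x y P; rewrite !hmap_Hnu //; apply: hc_swap.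
- move=> x P Q xP; have parE A B : hmap f (HPar A B) = HPar (hmap f A) (hmap f B) by [].
  rewrite parE !hmap_Hnu // parE.
  by apply: hc_extrude => /(hfree_hmap_inj f_inj).
- by move=> x P P' _; rewrite !hmap_Hnu //; apply: hc_nu.
- move=> x y P P' _; rewrite /Hout /= !hmap_habs //; exact: hc_out.
- move=> x y P P' _; rewrite /Hin /= !hmap_habs //; exact: hc_in.
Qed.

(** A transposition is used instead of [subst_name z y] because it is injective even when [y] and
    [z] differ, as [hcp_cong_hmap] requires. *)
Definition swap_name (y z v : name) : name :=
  if v == y then z else if v == z then y else v.

Lemma swap_nameK (y z : name) : involutive (swap_name y z).
Proof.
move=> v; rewrite /swap_name.
by case: (v =P y) => [->|/eqP/negPf vy];
  [case: (z =P y) => [->|] | case: (v =P z) => [->|/eqP/negPf vz]];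
  rewrite ?eqxx ?vy ?vz.
Qed.

(** This is alpha-conversion: as [z] is not free in [P], only occurrences of [y] become [z] and are
    abstracted. *)
Lemma habs_swap (y z : name) (P : hcp name) :
  ~ hfree z P -> habs z (hmap (swap_name y z) P) = habs y P.
Proof.
move=> zP; rewrite /habs hmap_comp; apply: eq_hmap_free => v vP /=.
rewrite /abs_name /swap_name; case: (v =P y) => _; first by rewrite eqxx.
by case: (v =P z) => [vz|/eqP/negPf->] //; case: zP; rewrite -vz.
Qed.

Lemma tr_Cnu (x : name) (P Q : cp name) :
  tr (Cnu x P Q) = Hnu x (HPar (tr P) (tr Q)).
Proof. by rewrite /Cnu /cabs /= !tr_cmap. Qed.

Lemma tr_Cin (x y : name) (P : cp name) : tr (Cin x y P) = Hin x y (tr P).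
Proof. by rewrite /Cin /cabs /= tr_cmap. Qed.

(** A free [y] in [Q] is distinct from the bound one, so in general the body is not a single
    abstraction of [y]. *)
Lemma tr_Cout (x y : name) (P Q : cp name) :
  tr (Cout x y P Q) = HOut x (HPar (habs y (tr P)) (hmap Some (tr Q))).
Proof. by rewrite /Cout /cabs /= tr_cmap. Qed.

Lemma tr_Cout_fresh (x y : name) (P Q : cp name) : ~ cfree y Q ->
  tr (Cout x y P Q) = Hout x y (HPar (tr P) (tr Q)).
Proof. by move=> yQ; rewrite tr_Cout -(@habs_fresh y) //; apply: notfree_tr. Qed.

Lemma hcp_cong_out (x y : name) (P P' Q Q' : hcp name) :
  hcp_cong P P' -> hcp_cong Q Q' ->
  hcp_cong (HOut x (HPar (habs y P) (hmap Some Q)))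
           (HOut x (HPar (habs y P') (hmap Some Q'))).
Proof.
move=> PP' QQ'.
(* Freshness for all four terms lets both components, on both sides, become abstractions of the same
   [z]; each side is then a named output, and [hc_out] applies. *)
have [z /= zF] := exists_fresh (HPar (HPar P P') (HPar Q Q')).
rewrite -!(@habs_swap y z) -?(@habs_fresh z); try by auto.
apply: (@hc_out x z (HPar _ _) (HPar _ _)); apply: hc_par => //.
exact: hcp_cong_hmap (inv_inj (swap_nameK y z)) PP'.
Qed.

(** The binder of [y] is extruded over [P], the two binders are swapped, and after regrouping the
    binder of [x] is narrowed to exclude [R]. *)
Lemma hcp_cong_assoc (x y : name) (P Q R : hcp name) :
  ~ hfree x R -> ~ hfree y P ->
  hcp_cong (Hnu x (HPar P (Hnu y (HPar Q R))))
           (Hnu y (HPar (Hnu x (HPar P Q)) R)).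
Proof.
move=> xR yP.
apply: hc_trans; first exact/hc_nu/hc_sym/hc_extrude.
apply: hc_trans; first exact: hc_swap.
apply: hc_nu; apply: hc_trans; first exact/hc_nu/hc_assoc.
apply: hc_trans; first exact/hc_nu/hc_comm.
by apply: hc_trans; [apply: hc_extrude | apply: hc_comm].
Qed.

Lemma hcp_cong_tr (P Q : cp name) : cp_cong P Q -> hcp_cong (tr P) (tr Q).
Proof.
elim=> {P Q}.
- exact: hc_link.
- by move=> x P Q; rewrite !tr_Cnu; apply/hc_nu/hc_comm.
- move=> x y P Q R xR yP; rewrite !tr_Cnu.
  by apply: hcp_cong_assoc; apply: notfree_tr.
- by move=> P; apply: hc_refl.
- by move=> P Q _; apply: hc_sym.
- by move=> P Q R _ PQ _; apply: hc_trans.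
- by move=> x P P' Q Q' _ PP' _ QQ'; rewrite !tr_Cnu; apply/hc_nu/hc_par.
- by move=> x y P P' Q Q' _ PP' _ QQ'; rewrite !tr_Cout; apply: hcp_cong_out.
- by move=> x y P P' _ PP'; rewrite !tr_Cin; apply: hc_in.
- by move=> x P P' _; apply: hc_wait.
- by move=> x P P' _; apply: hc_inl.
- by move=> x P P' _; apply: hc_inr.
- by move=> x P P' Q Q' _ PP' _; apply: hc_case.
Qed.

Theorem theorem30 (P Q : cp name) (hPQ : cp_red P Q) : hcp_red (tr P) (tr Q).
Proof.
elim: hPQ => {P Q}.
- by move=> w x P; rewrite tr_Cnu /csubst tr_cmap; apply: hr_link.
- move=> x y P Q R xP yQ; rewrite !tr_Cnu tr_Cin tr_Cout_fresh //.
  (* The HCP reduct groups [P] with [Q] under both binders; swapping the binders, reassociating and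
     moving [P] out of the scope of [x] gives the translated CP reduct. *)
  apply: hr_cong (hc_refl _) (hr_out _ _ _ _) _.
  apply: hc_trans; first exact: hc_swap.
  apply: hc_nu; apply: hc_trans; first exact/hc_nu/hc_sym/hc_assoc.
  by apply: hc_extrude; apply: notfree_tr.
- move=> x P; rewrite tr_Cnu /=.
  (* The translated close has continuation [HNil], which survives in the reduct and is absorbed by
     the unit law. *)
  apply: hr_cong (hc_refl _) (hr_close _ _ _) _.
  by apply: hc_trans (hc_comm _ _) (hc_nil _).
- by move=> x P Q R; rewrite !tr_Cnu; apply: hr_inl.
- by move=> x P Q R; rewrite !tr_Cnu; apply: hr_inr.
- by move=> x P P' Q _ PP'; rewrite !tr_Cnu; apply/hr_nu/hr_par.
- by move=> P Q Q' P' /hcp_cong_tr PQ _ QQ' /hcp_cong_tr; apply: hr_cong QQ'.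
Qed.
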